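(* Let $\Gamma$ be a finite set of constraint literals in the variable $x$ (rationality and integrality constraints), let $\overline{\Gamma}$ be its saturation and $\overline{\Gamma}_{\mathbb{Q}}$ the set of rationality literals in $\overline{\Gamma}$, and let $c\subseteq\mathbb{R}$ be an unbounded 1-cell. Then there exists a positive integer $d$ such that $d\mid k$ for every $(x^k\in\mathbb{Q})\in\overline{\Gamma}_{\mathbb{Q}}$ and $d\nmid k$ for every $(x^k\notin\mathbb{Q})\in\overline{\Gamma}_{\mathbb{Q}}$, if and only if there exists a real number $r\in c$ satisfying every literal of $\Gamma$ (where $(x^k\in\mathbb{Q})$ means $r^k\in\mathbb{Q}$, $(x^k\in\mathbb{Z})$ means $r^k\in\mathbb{Z}$, and similarly for the negated forms).
   Context: A constraint literal is a syntactic object of one of the four forms $(x^k\in\mathbb{Q})$, $(x^k\notin\mathbb{Q})$ (rationality literals), $(x^k\in\mathbb{Z})$, $(x^k\notin\mathbb{Z})$ (integrality literals), with $k$ a positive integer. The saturation $\overline{\Gamma}$ is the smallest set of literals containing $\Gamma$ and closed under the rules (for all positive integers $n,m$): (1) if $(x^n\notin\mathbb{Q})\in\overline{\Gamma}$ then $(x^n\notin\mathbb{Z})\in\overline{\Gamma}$; (2) if $(x^n\in\mathbb{Z})\in\overline{\Gamma}$ then $(x^n\in\mathbb{Q})\in\overline{\Gamma}$; (3) if $(x^n\in\mathbb{Z}),(x^m\notin\mathbb{Z})\in\overline{\Gamma}$ then $(x^1\notin\mathbb{Q})\in\overline{\Gamma}$; (4) if $(x^n\in\mathbb{Z}),(x^m\in\mathbb{Q})\in\overline{\Gamma}$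 then $(x^m\in\mathbb{Z})\in\overline{\Gamma}$; (5) if $(x^n\in\mathbb{Z}),(x^m\notin\mathbb{Z})\in\overline{\Gamma}$ then $(x^m\notin\mathbb{Q})\in\overline{\Gamma}$. An unbounded 1-cell is a set of the form $(-\infty,\alpha)$ with $\alpha\le 0$ or $(\alpha,+\infty)$ with $\alpha\ge 0$, where $\alpha$ is a real algebraic number (a real root of a nonzero polynomial in $\mathbb{Z}[x]$). *)

(* Defs.v *)
From HB Require Import structures.
From mathcomp Require Import all_boot all_order all_algebra.
From mathcomp Require Import boolp classical_sets cardinality set_interval reals.

Set Implicit Arguments.
Unset Strict Implicit.
Unset Printing Implicit Defensive.

Import Order.TTheory GRing.Theory Num.Theory.
Local Open Scope classical_set_scope.
Local Open Scope ring_scope.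

Record posnat := PosNat { posnat_val :> nat; _ : (0 < posnat_val)%N }.
HB.instance Definition _ := [isSub for posnat_val].
HB.instance Definition _ := [Equality of posnat by <:].

Definition posnat1 : posnat := @PosNat 1 isT.

Inductive literal : Type :=
  | InQ of posnat
  | NotInQ of posnat
  | InZ of posnat
  | NotInZ of posnat.

Definition rationality_literal (l : literal) : Prop :=
  match l with
  | InQ _ | NotInQ _ => True
  | InZ _ | NotInZ _ => False
  end.

Definition holds (R : realType) (r : R) (l : literal) : Prop :=
  match l with
  | InQ k => rational (r ^+ k)
  | NotInQ k => ~ rational (r ^+ k)
  | InZ k => r ^+ k \is a Num.int
  | NotInZ k => ~ (r ^+ k \is a Num.int)
  end.

Inductive saturation (G : set literal) : set literal :=
  | sat_base l : G l -> saturation G l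
  | sat_notQ_notZ n :
      saturation G (NotInQ n) -> saturation G (NotInZ n)
  | sat_Z_Q n :
      saturation G (InZ n) -> saturation G (InQ n)
  | sat_Z_notZ_notQ1 n m :
      saturation G (InZ n) -> saturation G (NotInZ m) ->
      saturation G (NotInQ posnat1)
  | sat_Z_Q_Z n m :
      saturation G (InZ n) -> saturation G (InQ m) -> saturation G (InZ m)
  | sat_Z_notZ_notQ n m :
      saturation G (InZ n) -> saturation G (NotInZ m) ->
      saturation G (NotInQ m).

Definition saturationQ (G : set literal) : set literal :=
  saturation G `&` [set l | rationality_literal l].

Definition real_algebraic (R : realType) (a : R) : Prop :=
  exists2 p : {poly int}, p != 0 & root (map_poly intr p) a.

Definition unbounded_cell (R : realType) (c : set R) : Prop :=
  exists2 a : R, real_algebraic a &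
    (a <= 0 /\ c = `]-oo, a[%classic) \/ (0 <= a /\ c = `]a, +oo[%classic).

(* Main.v *)
Require Import Defs.
From mathcomp Require Import all_boot all_order all_algebra.
From mathcomp Require Import boolp classical_sets cardinality set_interval reals.

Local Open Scope classical_set_scope.

(** A real point of the cell is nonzero, so its exponents [k] with [r ^ k]
    rational are the multiples of a fixed [d], or there are none; in the latter
    case any [d] beyond the finitely many exponents of [G] will do.
    Conversely, given [d], put [t = 2 ^ (1/d)], so that [t ^ k] is rational
    exactly when [d] divides [k].  Up to sign, [r = m t] with [m] a large
    integer works when the saturation contains an integrality literal, since
    then rationality and integrality of [r ^ k] coincide; otherwise
    [r = (m + 1/3) t] works, since none of its positive powers is an integer. *)

Section Literals.

Set Implicit Arguments.
Unset Strict Implicit.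

Import Order.TTheory GRing.Theory Num.Theory.
Local Open Scope ring_scope.

Variable R : realType.
Implicit Types (r t : R) (q : rat) (n m d k : nat) (G : set literal).

Lemma rationalM r t : rational r -> rational t -> rational (r * t).
Proof. by case=> p _ <- [q _ <-]; exists (p * q) => //; rewrite rmorphM. Qed.

Lemma rationalV r : rational r -> rational r^-1.
Proof. by case=> q _ <-; exists q^-1 => //; rewrite fmorphV. Qed.

Lemma rationalN r : rational r -> rational (- r).
Proof. by case=> q _ <-; exists (- q) => //; rewrite rmorphN. Qed.

Lemma rationalX r n : rational r -> rational (r ^+ n).
Proof. by case=> q _ <-; exists (q ^+ n) => //; rewrite rmorphXn. Qed.

Lemma rational_nat n : rational (n%:R : R).
Proof. by exists n%:R => //; rewrite ratr_nat. Qed.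

Lemma rational_int r : r \is a Num.int -> rational r.
Proof. by case/intrP=> z ->; exists z%:~R => //; rewrite ratr_int. Qed.

(** If [q ^+ n] is an integer, the [n]-th power of the denominator divides that of the numerator, so
    the denominator divides the numerator; being coprime to it, it is 1. *)
Lemma rational_expr_int r n :
  (0 < n)%N -> rational r -> r ^+ n \is a Num.int -> r \is a Num.int.
Proof.
move=> n0 [q _ <-]; rewrite -rmorphXn /= => /intrP[z].
rewrite -(ratr_int R) => /(fmorph_inj (@ratr R)) qz.
suff dq1 : denq q = 1 by rewrite -(divq_num_den q) dq1 divr1 ratr_int intr_int.
have eq_num : numq q ^+ n = z * denq q ^+ n.
  apply: (@intr_inj rat).
  by rewrite rmorphM !rmorphXn /= -qz -exprMn [X in X ^+ _ = _]numqE.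
have : (`|denq q| ^ n %| `|numq q| ^ n)%N.
  by rewrite -!abszX eq_num abszM dvdn_mull.
rewrite dvdn_pexp2r // => den_num.
have := coprime_num_den q.
rewrite /coprime (gcdn_idPr den_num) => /eqP den1.
by rewrite -[LHS]gez0_abs ?den1 // denq_ge0.
Qed.

Lemma root2_exists d : (0 < d)%N -> exists2 t : R, 0 < t & t ^+ d = 2%:R.
Proof.
move=> d0.
have [t /andP[t0 _]] : exists2 t : R, 0 <= t <= 2%:R & root ('X^d - 2%:R%:P) t.
  apply: poly_ivt; first exact: ler0n.
  rewrite !hornerE expr0n eqn0Ngt d0 sub0r oppr_le0 ler0n subr_ge0.
  by rewrite -natrX ler_nat -[X in (X <= _)%N]expn1 leq_exp2l.
rewrite rootE !hornerE subr_eq0 => /eqP td; exists t => //.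
rewrite lt_neqAle t0 andbT; apply/eqP => t_eq0.
by have /eqP := td; rewrite -t_eq0 expr0n eqn0Ngt d0 eq_sym pnatr_eq0.
Qed.

(** If [t ^+ k] is a rational [q], then [q ^+ d = 2 ^ k]; comparing 2-adic valuations of numerator
    and denominator shows that [d] divides [k]. *)
Lemma rational_root2X t d k :
  (0 < d)%N -> t ^+ d = 2%:R -> rational (t ^+ k) <-> (d %| k)%N.
Proof.
move=> d0 td; split=> [[q _ qtk]|/dvdnP[j ->]]; last first.
  by rewrite mulnC exprM td; apply/rationalX/rational_nat.
have q2 : q ^+ d = 2%:R ^+ k.
  apply: (fmorph_inj (@ratr R)).
  by rewrite !rmorphXn /= qtk ratr_nat -exprM mulnC exprM td.
have eq_num : numq q ^+ d = 2%:Z ^+ k * denq q ^+ d.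
  apply: (@intr_inj rat).
  by rewrite rmorphM !rmorphXn /= -q2 -exprMn [X in X ^+ _ = _]numqE.
have num_gt0 : (0 < `|numq q|)%N.
  rewrite absz_gt0 numq_eq0; apply/eqP => q0; move/eqP: q2.
  by rewrite q0 expr0n eqn0Ngt d0 eq_sym expf_eq0 pnatr_eq0 andbF.
have den_gt0 : (0 < `|denq q|)%N by rewrite absz_gt0 denq_neq0.
have /(congr1 (logn 2)) : (`|numq q| ^ d = 2 ^ k * `|denq q| ^ d)%N.
  by rewrite -!abszX eq_num abszM abszX.
rewrite lognM ?expn_gt0 ?den_gt0 // !lognX (logn_prime 2 (q := 2)) // muln1 => eqk.
by rewrite -(dvdn_addl _ (dvdn_mulr (logn 2 `|denq q|) (dvdnn d))) -eqk dvdn_mulr.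
Qed.

(** Were the power an integer [z], its [d]-th power would give [(z * 3 ^ k) ^ d = (3 * m + 1) ^ (k *
    d) * 2 ^ k], where 3 divides only the left side. *)
Lemma third_root2X_notint t d k m : (0 < d)%N -> (0 < k)%N ->
  t ^+ d = 2%:R -> ~ ((3 * m + 1)%:R / 3%:R * t) ^+ k \is a Num.int.
Proof.
move=> d0 k0 td /intrP[z zE].
have zd : (z * 3%:Z ^+ k) ^+ d = (3 * m + 1)%:Z ^+ (k * d) * 2%:Z ^+ k.
  apply: (@intr_inj R); rewrite rmorphM !rmorphXn rmorphM rmorphXn /= -zE.
  rewrite -exprMn mulrAC mulfVK ?pnatr_eq0 // -exprM exprMn.
  by congr (_ * _); rewrite mulnC exprM td.
have : (3 %| (3 * m + 1) ^ (k * d) * 2 ^ k)%N.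
  have <- : ((`|z| * 3 ^ k) ^ d = (3 * m + 1) ^ (k * d) * 2 ^ k)%N.
    by have := congr1 absz zd; rewrite abszX !abszM !abszX.
  by rewrite Euclid_dvdX // d0 andbT dvdn_mull // dvdn_exp.
rewrite Euclid_dvdM // !Euclid_dvdX // (_ : (3 %| 2)%N = false) // orbF.
by case/andP; rewrite dvdn_addr ?dvdn_mulr.
Qed.

Lemma unbounded_cell_neq0 (c : set R) r : unbounded_cell c -> c r -> r != 0.
Proof.
case=> a _ [[a0 ->]|[a0 ->]] /=; rewrite in_itv /= ?andbT => ra.
  by rewrite lt_eqF // (lt_le_trans ra).
by rewrite gt_eqF // (le_lt_trans a0).
Qed.

Lemma rational_exponents r m : r != 0 ->
  exists2 d, (0 < d)%N & forall k, (0 < k)%N ->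
    (rational (r ^+ k) -> (d %| k)%N) /\
    ((k <= m)%N -> (d %| k)%N -> rational (r ^+ k)).
Proof.
move=> r0; set P := fun k => (0 < k)%N && `[< rational (r ^+ k) >].
have [exP|noP] := pselect (exists k, P k).
  case: (ex_minnP exP) => d /andP[d0 /asboolP rd] dmin; exists d => // k k0.
  have rdX j : rational (r ^+ (j * d)) by rewrite mulnC exprM; exact: rationalX.
  split=> [rk|_ /dvdnP[j ->]]; last exact: rdX.
  rewrite /dvdn; apply: contraT; rewrite -lt0n => mod_gt0.
  (* [d] is the least positive exponent with a rational power, so a nonzero remainder with the same
     property is impossible. *)
  suff : P (k %% d)%N by move/dmin; rewrite leqNgt ltn_mod d0.
  rewrite /P mod_gt0; apply/asboolP.
  suff -> : r ^+ (k %% d)%N = r ^+ k * (r ^+ (k %/ d * d)%N)^-1.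
    by apply: rationalM => //; exact: rationalV.
  by rewrite {2}(divn_eq k d) exprD mulrAC divff ?mul1r // expf_neq0.
(* No positive power is rational: [m.+1] divides no positive [k <= m]. *)
exists m.+1 => // k k0; split=> [rk|km].
  by case: noP; exists k; rewrite /P k0; apply/asboolP.
by move/(dvdn_leq k0); rewrite ltnNge km.
Qed.

Lemma posnat_gt0 (k : posnat) : (0 < k)%N.
Proof. exact: valP. Qed.

(** The last three rules rest on [rational_expr_int], applied to [r] itself or to [r ^+ m], whose
    [n]-th power is the integer [(r ^+ n) ^+ m]. *)
Lemma holds_saturation G r :
  (forall l, G l -> holds r l) -> forall l, saturation G l -> holds r l.
Proof.
move=> holdsG l; elim=> {l} /= [l /holdsG //|n _ rn|n _ rn|n m _ rn _ rm
  |n m _ rn _ rm|n m _ rn _ rm].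
- by move/rational_int.
- exact: rational_int.
- rewrite expr1 => rQ; apply: rm; apply: rpredX.
  exact: rational_expr_int (posnat_gt0 n) rQ rn.
- apply: (rational_expr_int (posnat_gt0 n) rm).
  by rewrite exprAC rpredX.
- move=> rQ; apply: rm; apply: (rational_expr_int (posnat_gt0 n) rQ).
  by rewrite exprAC rpredX.
Qed.

Lemma holdsN r l : holds (- r) l -> holds r l.
Proof.
have rN k : rational ((- r) ^+ k) <-> rational (r ^+ k).
  rewrite exprNn -signr_odd; case: (odd k); rewrite ?expr1 ?expr0 ?mulN1r ?mul1r //.
  by split=> /rationalN; rewrite ?opprK.
have zN k : ((- r) ^+ k \is a Num.int) = (r ^+ k \is a Num.int).
  by rewrite exprNn rpredMsign.
by case: l => k /=; rewrite ?rN ?zN.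
Qed.

Definition exponent (l : literal) : nat :=
  match l with InQ k | NotInQ k | InZ k | NotInZ k => k end.

Lemma finite_set_exponent_bound G :
  finite_set G -> exists m, forall l, G l -> (exponent l <= m)%N.
Proof.
move=> /(finite_image exponent)/finite_seqP[s sE].
exists (\max_(k <- s) k) => l Gl.
have : [set exponent l | l in G] (exponent l) by exists l.
by rewrite sE /= => ls; apply: leq_bigmax_seq.
Qed.

(** The only exponent a rule can introduce is 1, whence the maximum with 1. *)
Lemma saturation_exponent_bound G m :
  (forall l, G l -> (exponent l <= m)%N) ->
  forall l, saturation G l -> (exponent l <= maxn 1 m)%N.
Proof.
move=> Gm l; elim=> {l} //= [l /Gm|n p _ _ _ _]; last by rewrite leq_maxl.
by move=> lm; rewrite leq_max lm orbT.
Qed.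

Lemma large_solution G d (a : R) : (0 < d)%N ->
  (forall k : posnat, saturation G (InQ k) -> (d %| k)%N) ->
  (forall k : posnat, saturation G (NotInQ k) -> ~ (d %| k)%N) ->
  exists2 r, a < r & forall l, G l -> holds r l.
Proof.
move=> d0 inQ notinQ; have [t t0 td] := root2_exists d0.
have at_ge0 : 0 <= `|a| / t by rewrite divr_ge0 // ltW.
set m := Num.bound (`|a| / t).
have a_lt : a < m%:R * t.
  by apply: (le_lt_trans (ler_norm a)); rewrite -ltr_pdivrMr //; exact: archi_boundP.
(* A nonzero rational factor does not change which powers are rational. *)
have rational_mulX (c : R) k : c != 0 -> rational c ->
    rational ((c * t) ^+ k) <-> (d %| k)%N.
  move=> c0 cQ; rewrite -(rational_root2X k d0 td) exprMn.
  split=> rk; last by apply: rationalM => //; exact: rationalX.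
  rewrite -[t ^+ k](mulKf (expf_neq0 k c0)).
  by apply: rationalM => //; apply/rationalV/rationalX.
have [[n satZ]|nosatZ] := pselect (exists n : posnat, saturation G (InZ n)).
  have m0 : m%:R != 0 :> R.
    rewrite pnatr_eq0 -lt0n -(ltr_nat R).
    exact: le_lt_trans at_ge0 (archi_boundP at_ge0).
  have mQ k : rational ((m%:R * t) ^+ k) <-> (d %| k)%N.
    exact: rational_mulX m0 (rational_nat m).
  exists (m%:R * t) => // -[] k /sat_base Gk /=.
  - by apply/mQ/inQ.
  - by move/mQ; exact: notinQ.
  (* With [k = j * d], the power is [(m ^ d * 2) ^ j], an integer. *)
  - have /dvdnP[j ->] := inQ _ (sat_Z_Q Gk).
    by rewrite mulnC exprM exprMn td rpredX // rpredM ?rpredX ?rpred_nat.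
  (* The integrality literal [satZ] turns non-integrality into irrationality, which [d] controls. *)
  - by move/rational_int/mQ; apply: notinQ (sat_Z_notZ_notQ satZ Gk).
set c : R := (3 * m + 1)%:R / 3%:R.
have c_gt : m%:R < c.
  by rewrite ltr_pdivlMr ?ltr0n // -natrM ltr_nat mulnC addn1.
have c0 : c != 0 by rewrite gt_eqF // (le_lt_trans _ c_gt).
have cQ k : rational ((c * t) ^+ k) <-> (d %| k)%N.
  by apply: rational_mulX => //; apply/rationalM/rationalV; exact: rational_nat.
exists (c * t); first by rewrite (lt_trans a_lt) // ltr_pM2r.
case=> k /sat_base Gk /=.
- by apply/cQ/inQ.
- by move/cQ; exact: notinQ.
- by case: nosatZ; exists k.
- exact: third_root2X_notint (posnat_gt0 k) td.
Qed.

End Literals.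

Theorem theorem5 (R : realType) (G : set literal) (c : set R)
    (hG : finite_set G) (hc : unbounded_cell c) :
  (exists2 d : nat, (0 < d)%N &
     (forall k : posnat, saturationQ G (InQ k) -> (d %| k)%N) /\
     (forall k : posnat, saturationQ G (NotInQ k) -> ~ (d %| k)%N))
  <->
  (exists2 r : R, c r & forall l : literal, G l -> holds r l).
Proof.
split=> [[d d0 [inQ notinQ]]|[r cr holdsG]].
  have solution (a : R) := large_solution a d0
    (fun k Gk => inQ k (conj Gk I)) (fun k Gk => notinQ k (conj Gk I)).
  case: hc => a _ [[_ ->]|[_ ->]]; last first.
    by have [r ar rG] := solution a; exists r; rewrite //= in_itv /= ar.
  (* The left-hand cell is the mirror image of a right-hand one, and literals are insensitive to the
     sign of [r]. *)
  have [r ar rG] := solution (- a)%R; exists (- r)%R.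
    by rewrite /= in_itv /= Num.Theory.ltrNl.
  by move=> l /rG rl; apply: holdsN; rewrite GRing.opprK.
have r0 := unbounded_cell_neq0 hc cr.
have [m Gm] := finite_set_exponent_bound hG.
(* This bound covers the exponents of the whole saturation, as the [NotInQ] case requires. *)
have [d d0 dP] := rational_exponents (maxn 1 m) r0.
have holds_sat := holds_saturation holdsG.
exists d => //; split=> k [Gk _]; have [rQ Qr] := dP k (posnat_gt0 k).
  exact/rQ/(holds_sat _ Gk).
move=> dk; apply: (holds_sat _ Gk); apply: Qr dk.
exact: saturation_exponent_bound Gm _ Gk.
Qed.
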